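(* For each $m\ge2$, the leading coefficients $\gamma(m)$ of $p_m(g)$ and $\lambda(m)$ of $H_m(q)$ are given by \[ \gamma(m)=\mathrm{vol}\big(\mathcal C(\mathbb Z_m)\cap\{x\in\mathbb R^{m-1}: x_1+\cdots+x_{m-1}=1\}\big),\qquad \lambda(m)=\mathrm{vol}\big(O_m\cap\{x\in\mathbb R^{m}: x_m=1\}\big), \] where $\mathrm{vol}$ denotes relative volume.
   Context: A numerical semigroup is a subset $S\subseteq\mathbb Z_{\ge0}$ closed under addition with finite complement; its genus is $|\mathbb Z_{\ge0}\setminus S|$ and its multiplicity its smallest positive element. $N_m(g)$ is the number of numerical semigroups of multiplicity $m$ and genus $g$; it is known that there is a quasipolynomial $p_m(g)$ of degree $m-2$ with constant leading coefficient $\gamma(m)$ such that $N_m(g)=p_m(g)$ for all sufficiently large $g$. For coprime positive integers $n,q$, $o(n,q)$ is the number of numerical semigroups containing $n$ and $q$; it is known there is a quasipolynomial $H_n(q)$ of degree $n-1$ with constant leading coefficient $\lambda(n)$ such that $H_n(q)=o(n,q)$ for every positive $q$ coprime to $n$. The group cone $\mathcal C(\mathbb Z_m)\subset\mathbb R^{m-1}$ is the set of $x$ (coordinates indexed by nonzero residues mod $m$) with $x_a+x_b\ge x_{a+b}$ for all nonzero $a,b$ with $a+b\ne0$. The oversemigroup cone $O_m\subset\mathbb R^m$ is the set of $y$ with $y_i+y_j\le y_{i+j}$ for $1\le i\le j\le m-1$, $i+j<m$, and $y_i+y_j\le y_{i+j-m}+y_m$ for $1\le i\le j\le m-1$, $i+j>m$.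 The relative volume of a set whose affine span has dimension $d$ is its $d$-dimensional volume normalized with respect to the integer lattice in (the linear space parallel to) its affine span.
   Formalization: The cone O_m is taken with the extra conditions y_i ≥ 0 for all i and y_i + y_j ≤ y_m when i + j = m (the latter new only for m = 2), since otherwise the slice y_m = 1 has infinite volume; numerical semigroups are required to contain 0. *)

(* Defs.v *)
From HB Require Import structures.
From mathcomp Require Import all_boot all_order all_algebra finmap.
From mathcomp Require Import all_classical all_reals all_analysis.
From mathcomp Require Import zify lra.

Set Implicit Arguments.
Unset Strict Implicit.
Unset Printing Implicit Defensive.

Import Order.TTheory GRing.Theory Num.Theory.
Import numFieldNormedType.Exports.

Local Open Scope classical_set_scope.
Local Open Scope ring_scope.

(* [0] is required to lie in [S]: the counts below depend on this convention. *)
Definition numerical_semigroup (S : set nat) : Prop :=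
  [/\ S 0%N, forall a b, S a -> S b -> S (a + b)%N & finite_set (~` S)].

Definition genus (S : set nat) : nat := #|` fset_set (~` S)|%fset.

Definition has_multiplicity (S : set nat) (m : nat) : Prop :=
  [/\ (0 < m)%N, S m & forall k, S k -> (0 < k)%N -> (m <= k)%N].

(* [fset_set] returns the empty set on infinite sets; the two sets of
   semigroups counted below are finite (the second when [n] and [q] are
   coprime and positive), so these are the genuine cardinalities. *)
Definition semigroup_count (m g : nat) : nat :=
  #|` fset_set [set S : set nat | [/\ numerical_semigroup S,
                                     has_multiplicity S m & genus S = g]]|%fset.

Definition oversemigroup_count (n q : nat) : nat :=
  #|` fset_set [set S : set nat | [/\ numerical_semigroup S, S n & S q]]|%fset.

Definition periodic (T : Type) (f : nat -> T) : Prop :=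
  exists2 N : nat, (0 < N)%N & forall n, f (n + N)%N = f n.

(* [p] is a quasipolynomial of degree exactly [d] whose coefficient of degree
   [d] is the constant function [l]. *)
Definition quasipolynomial (R : realType) (d : nat) (l : R) (p : nat -> R) :
    Prop :=
  exists c : 'I_d.+1 -> nat -> R,
    [/\ forall i, periodic (c i),
        forall n, p n = \sum_(i < d.+1) c i n * n%:R ^+ i,
        forall n, c ord_max n = l
      & l != 0].

(* Lebesgue measure on R^d as the d-fold product of [lebesgue_measure]: the
   recursive clause is the definition of the product measure through the
   sections of [A] along the first coordinate. On R^0 it is the Dirac mass. *)
Fixpoint lebesgue_volume (R : realType) (d : nat) : set 'rV[R]_d -> \bar R :=
  match d return set 'rV[R]_d -> \bar R with
  | 0 => fun A => (\1_A 0)%:E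
  | d'.+1 => fun A =>
      (\int[lebesgue_measure]_(t in [set: R])
         lebesgue_volume
           [set v : 'rV[R]_d' | A (row_mx (t%:M : 'rV[R]_1) v)])%E
  end.

Section RelativeVolume.
Context {R : realType} {n : nat}.
Implicit Type P V : set 'rV[R]_n.

Definition affine_span P : set 'rV[R]_n :=
  [set x | exists k (w : 'I_k -> R) (v : 'I_k -> 'rV[R]_n),
     [/\ forall i, P (v i), \sum_i w i = 1 & x = \sum_i w i *: v i]].

Definition direction P : set 'rV[R]_n :=
  [set u | exists x y, [/\ affine_span P x, affine_span P y & u = x - y]].

(* The rows of [B] are at the same time a basis of the real vector space [V]
   and a Z-basis of the lattice of integer points of [V]. *)
Definition lattice_basis V (d : nat) (B : 'M[R]_(d, n)) : Prop :=
  [/\ row_free B,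
      V = [set t *m B | t in [set: 'rV[R]_d]]
    & V `&` [set x | x \is a mxOver Num.int] =
      [set z *m B | z in [set z : 'rV[R]_d | z \is a mxOver Num.int]]].

(* The value does not depend on the base point [p] nor on the lattice basis
   [B]; it is 0 by convention when [P] is empty or when the direction of its
   affine span has no basis of integer vectors. *)
Definition relative_volume P : \bar R :=
  xget 0%E [set r | exists d (p : 'rV[R]_n) (B : 'M[R]_(d, n)),
    [/\ affine_span P p, lattice_basis (direction P) B
      & r = lebesgue_volume [set t : 'rV[R]_d | P (p + t *m B)]]].

End RelativeVolume.

(* The coordinate of index [i], 1 <= i <= n, of a vector of R^n, so that
   [coord1 x j.+1 = x 0 j]; it is 0 when [i] is out of range. *)
Definition coord1 (R : realType) (n : nat) (x : 'rV[R]_n) (i : nat) : R :=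
  \sum_(j < n | j.+1 == i) x 0 j.

Definition group_cone (R : realType) (m : nat) : set 'rV[R]_m.-1 :=
  [set x | forall a b : nat, (0 < a < m)%N -> (0 < b < m)%N ->
     ((a + b) %% m != 0)%N ->
     coord1 x ((a + b) %% m) <= coord1 x a + coord1 x b].

(* For a semigroup S containing m and q, iq - m y_i is the least element of S
   congruent to iq mod m (0 < i < m) and y_m = q. As iq lies in S, y_i >= 0;
   without this condition the slice y_m = 1 is unbounded (take y_i = - t for
   i < m and t large). The last clause is the inequality for i + j = m, where
   the least element of the class is 0. It follows from the two clauses before
   it when m >= 3, see [oversemigroup_cone_eqm], but not when m = 2, where it
   is the only upper bound on y_1. *)
Definition oversemigroup_cone (R : realType) (m : nat) : set 'rV[R]_m :=
  [set y | [/\ forall i, (1 <= i <= m)%N -> 0 <= coord1 y i,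
     forall i j, (1 <= i)%N -> (i <= j)%N -> (j <= m.-1)%N -> (i + j < m)%N ->
       coord1 y i + coord1 y j <= coord1 y (i + j),
     forall i j, (1 <= i)%N -> (i <= j)%N -> (j <= m.-1)%N -> (m < i + j)%N ->
       coord1 y i + coord1 y j <= coord1 y (i + j - m) + coord1 y m
   & forall i j, (1 <= i)%N -> (i <= j)%N -> (j <= m.-1)%N -> (i + j = m)%N ->
       coord1 y i + coord1 y j <= coord1 y m]].

Arguments group_cone R m : clear implicits.
Arguments oversemigroup_cone R m : clear implicits.

Lemma oversemigroup_cone_eqm (R : realType) (m : nat) (y : 'rV[R]_m) :
  (3 <= m)%N ->
  (forall i j, (1 <= i)%N -> (i <= j)%N -> (j <= m.-1)%N -> (i + j < m)%N ->
     coord1 y i + coord1 y j <= coord1 y (i + j)) ->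
  (forall i j, (1 <= i)%N -> (i <= j)%N -> (j <= m.-1)%N -> (m < i + j)%N ->
     coord1 y i + coord1 y j <= coord1 y (i + j - m) + coord1 y m) ->
  forall i j, (1 <= i)%N -> (i <= j)%N -> (j <= m.-1)%N -> (i + j = m)%N ->
    coord1 y i + coord1 y j <= coord1 y m.
Proof.
move: (coord1 y) => f m3 lt_m gt_m.
have lt_m' i j : (0 < i)%N -> (0 < j)%N -> (i + j < m)%N ->
    f i + f j <= f (i + j)%N.
  move=> i0 j0 ijm; case: (leqP i j) => ij; first by apply: lt_m => //; lia.
  by rewrite addrC addnC; apply: lt_m => //; lia.
have gt_m' i j : (i < m)%N -> (j < m)%N -> (m < i + j)%N ->
    f i + f j <= f (i + j - m)%N + f m.
  move=> im jm ijm; case: (leqP i j) => ij; first by apply: gt_m => //; lia.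
  by rewrite addrC addnC; apply: gt_m => //; lia.
have split_sum a b : \sum_(k < a + b.+1) f k.+1 =
    \sum_(k < a) f k.+1 + (f a.+1 + \sum_(k < b) f (a.+1 + k.+1)%N).
  rewrite big_split_ord big_ord_recl /= addn0.
  by do 2![congr (_ + _)]; apply: eq_bigr => k _; rewrite addSnnS.
have key a b : (a.+1 + b.+1 = m)%N ->
    f a.+1 *+ (a + b).+1 <= f b.+1 + f m *+ a.
  move=> abm.
  have le1 : \sum_(k < b) (f a.+1 + f k.+1) <=
             \sum_(k < b) f (a.+1 + k.+1)%N.
    by apply: ler_sum => k _; apply: lt_m' => //; have := ltn_ord k; lia.
  have le2 : \sum_(k < a) (f a.+1 + f (b.+1 + k.+1)%N) <=
             \sum_(k < a) (f k.+1 + f m).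
    apply: ler_sum => k _; have := ltn_ord k => ka.
    have -> : k.+1 = (a.+1 + (b.+1 + k.+1) - m)%N by lia.
    have -> : (b.+1 + (a.+1 + (b.+1 + k.+1) - m) = b.+1 + k.+1)%N by lia.
    by apply: gt_m'; lia.
  have := split_sum a b; have := split_sum b a; rewrite !addnS [(b + a)%N]addnC.
  move: le1 le2; rewrite !big_split /= !sumr_const !card_ord mulrS mulrnDr.
  move=> le1 le2 -> /esym; lra.
case=> [//|a] [//|b] _ _ _ abm.
have ka := key a b abm.
have kb : f b.+1 *+ (a + b).+1 <= f a.+1 + f m *+ b.
  by rewrite (addnC a); apply: key; rewrite addnC.
have ab0 : (0 < a + b)%N by lia.
rewrite -(ler_pMn2r ab0) mulrnDl (mulrnDr (f m)).
by move: ka kb; rewrite !mulrS; lra.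
Qed.

(* Main.v *)
Require Import Defs.
From HB Require Import structures.
From mathcomp Require Import all_boot all_order all_algebra finmap.
From mathcomp Require Import all_classical all_reals all_analysis.
From mathcomp Require Import measurable_realfun zify ring lra.

Import Order.TTheory GRing.Theory Num.Theory.
Import numFieldNormedType.Exports.

Local Open Scope classical_set_scope.
Local Open Scope ring_scope.

Set Implicit Arguments.
Unset Strict Implicit.
Unset Printing Implicit Defensive.

(* Kunz coordinates identify both families of semigroups with the lattice
   points of a dilated polytope whose facets are moved by a bounded amount: the
   semigroups of multiplicity [m] and genus [g] with the integer points of the
   [g]-th dilate of the slice of the group cone, and, when [q = m j + 1], the
   oversemigroups of [<m, q>] with those of the [q]-th dilate of the slice of
   the oversemigroup cone. It is enough to let [q] run through this progression,
   since the leading coefficient of a quasipolynomial is its limit along any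
   sequence. The number of such points, divided by the right power of the
   dilation factor, tends to the volume in the coordinates given by any lattice
   basis, because the points themselves do not depend on the basis; this also
   shows that the relative volume is well defined. *)

(** * Grid points of polyhedra *)

Section GridCount.
Context {R : realType}.

Definition polyhedron (d : nat) (I : Type) (A : I -> 'cV[R]_d) (b : I -> R) :
    set 'rV[R]_d := [set x | forall i, (x *m A i) 0 0 <= b i].

Definition box (d : nat) (u : 'rV[R]_d) (C : nat) : set 'rV[R]_d :=
  [set x | forall j, u 0 j - C%:R <= x 0 j < u 0 j + C%:R].

(** For [a < 2 C k] these are the points of [u + Z / k] in the interval [[u - C, u + C[], counted
    from its left end. *)
Definition grid_point (u : R) (k C a : nat) : R :=
  u + (a%:R - (C * k)%:R) / k%:R.

Definition grid_vec (d : nat) (u : 'rV[R]_d) (k C : nat)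
    (v : 'rV['I_(C * k).*2]_d) : 'rV[R]_d :=
  \row_j grid_point (u 0 j) k C (v 0 j).

(** A Riemann sum for the volume of [P] within [box u C]: each grid point carries the volume [k^-d]
    of its cell. *)
Definition grid_count (d : nat) (u : 'rV[R]_d) (k C : nat)
    (P : set 'rV[R]_d) : R :=
  (\sum_(v : 'rV['I_(C * k).*2]_d) \1_P (grid_vec u v)) / k%:R ^+ d.

Lemma grid_count_ge0 d (u : 'rV[R]_d) k C P : 0 <= grid_count u k C P.
Proof.
by rewrite divr_ge0 ?exprn_ge0// sumr_ge0// => v _; rewrite indicE.
Qed.

Lemma grid_count_le d (u : 'rV[R]_d) k C P : (0 < k)%N ->
  grid_count u k C P <= (C.*2)%:R ^+ d.
Proof.
move=> k0; rewrite ler_pdivrMr ?exprn_gt0 ?ltr0n//.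
rewrite -exprMn -natrM -doubleMl.
apply: (@le_trans _ _ (\sum_(v : 'rV['I_(C * k).*2]_d) 1)).
  by apply: ler_sum => v _; rewrite indicE; case: (_ \in _).
by rewrite sumr_const card_mx card_ord mul1n -natrX.
Qed.

Lemma sum_rV_recl (T : finType) d (F : 'rV[T]_(1 + d) -> R) :
  \sum_v F v = \sum_(a : T) \sum_(w : 'rV[T]_d) F (row_mx (const_mx a) w).
Proof.
rewrite pair_bigA /=.
rewrite (reindex (fun p : T * 'rV[T]_d =>
  row_mx (const_mx p.1 : 'rV[T]_1) p.2)) //=.
exists (fun v : 'rV[T]_(1 + d) => (lsubmx v 0 0, rsubmx v)) => [[a w] _|v _] /=.
  by rewrite row_mxKl row_mxKr mxE.
rewrite -[RHS]hsubmxK; congr row_mx.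
by apply/matrixP => i j; rewrite !ord1 !mxE.
Qed.

(** The discrete counterpart of the recursive clause of [lebesgue_volume]. *)
Lemma grid_countS d (u : 'rV[R]_(1 + d)) k C P :
  grid_count u k C P = k%:R^-1 * \sum_(a < (C * k).*2)
    grid_count (rsubmx u) k C
      [set v | P (row_mx ((grid_point (lsubmx u 0 0) k C a)%:M : 'rV[R]_1) v)].
Proof.
rewrite /grid_count sum_rV_recl -mulr_suml exprS invfM mulrCA.
congr (_ * (_ * _)).
apply: eq_bigr => a _; apply: eq_bigr => w _; rewrite !indicE; congr (_%:R).
congr nat_of_bool; apply/asbool_equiv_eq => /=.
suff -> : grid_vec u (row_mx (const_mx a : 'rV_1) w) =
  row_mx (grid_point (lsubmx u 0 0) k C a)%:M (grid_vec (rsubmx u) w) by [].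
apply/matrixP => i j; rewrite ord1 !mxE.
by case: (splitP j) => j' jj'; rewrite !mxE ?ord1 ?eqxx ?mulr1n;
   congr grid_point; congr (u _ _); apply: val_inj; rewrite //= jj' ?ord1.
Qed.

(** The contribution of the first coordinate moves to the right-hand side, so slices remain
    polyhedra and induction on the dimension is possible. *)
Lemma polyhedron_slice d (I : Type) (A : I -> 'cV[R]_(1 + d)) (b : I -> R) t :
  [set v | polyhedron A b (row_mx (t%:M : 'rV[R]_1) v)] =
  polyhedron (fun i => dsubmx (A i)) (fun i => b i - t * usubmx (A i) 0 0).
Proof.
have E v i : ((row_mx (t%:M : 'rV[R]_1) v) *m A i) 0 0 =
    t * usubmx (A i) 0 0 + (v *m dsubmx (A i)) 0 0.
  by rewrite -[in LHS](vsubmxK (A i)) mul_row_col mxE mul_scalar_mx [in LHS]mxE.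
by apply/seteqP; split => v /= H i; have := H i; rewrite E; lra.
Qed.

Lemma box_slice d (u : 'rV[R]_(1 + d)) C t v :
  box u C (row_mx (t%:M : 'rV[R]_1) v) <->
  (lsubmx u 0 0 - C%:R <= t < lsubmx u 0 0 + C%:R) /\ box (rsubmx u) C v.
Proof.
split=> [H|[H1 H2] j].
  split; [have := H (lshift d 0)|move=> j; have := H (rshift 1 j)].
    by rewrite row_mxEl !mxE eqxx mulr1n.
  by rewrite row_mxEr !mxE.
rewrite -[u]hsubmxK !mxE; case: (splitP j) => j' _; last exact: H2.
by rewrite !ord1 !mxE eqxx mulr1n; move: H1; rewrite mxE.
Qed.

End GridCount.

(** * Step functions on a one-dimensional grid *)

Section StepFunction.
Context {R : realType}.
Variables (u : R) (k C : nat).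
Hypothesis k_gt0 : (0 < k)%N.

Let k0 : (0 : R) < k%:R. Proof. by rewrite ltr0n. Qed.

Definition cell (a : nat) : set R :=
  [set` `[grid_point u k C a, grid_point u k C a + k%:R^-1[].

Lemma measurable_cell a : measurable (cell a).
Proof. exact: measurable_itv. Qed.

Lemma lebesgue_measure_cell a : lebesgue_measure (cell a) = (k%:R^-1)%:E.
Proof.
rewrite /cell lebesgue_measure_itv/= lte_fin ltrDl invr_gt0 k0.
by rewrite -EFinD addrAC subrr add0r.
Qed.

Definition step (c : nat -> R) (t : R) : R :=
  \sum_(a < (C * k).*2) c a * \1_(cell a) t.

(** Measured from [u - C] in units of [1 / k], the cells are the intervals [[a, a + 1[], so
    truncation finds the cell of [t]. *)
Lemma cellE a t : cell a t = (a%:R <= (t - u + C%:R) * k%:R < a.+1%:R) :> Prop.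
Proof.
rewrite /cell /= in_itv /= /grid_point; congr is_true.
have e x : (u + (x - (C * k)%:R) / k%:R <= t) = (x <= (t - u + C%:R) * k%:R).
  by rewrite -lerBrDl ler_pdivrMr// lerBlDr natrM -mulrDl.
congr andb; first exact: e.
rewrite -[in RHS](natr1 a) -addrA -[X in _ + (_ + X)]mul1r -mulrDl.
by rewrite -[LHS]negbK -leNgt addrAC e leNgt negbK.
Qed.

Lemma step_inside c t : u - C%:R <= t < u + C%:R ->
  exists a : nat, [/\ step c t = c a, grid_point u k C a <= t,
    t < grid_point u k C a + k%:R^-1 & (a < (C * k).*2)%N].
Proof.
move=> /andP[tl tr]; set s := (t - u + C%:R) * k%:R.
have s0 : 0 <= s by apply: mulr_ge0; [lra|exact: ltW].
have sC : (Num.truncn s < (C * k).*2)%N.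
  rewrite truncn_lt_nat// -muln2 -mulnA (mulnC k) mulnA natrM.
  by rewrite ltr_pM2r// natrM; lra.
exists (Num.truncn s).
have E : cell (Num.truncn s) t by rewrite cellE; exact: truncn_itv.
have := E; rewrite {1}/cell/= in_itv/= => /andP[g1 g2]; split => //.
rewrite /step (bigD1 (Ordinal sC))//= big1 => [|a aN].
  by rewrite addr0 indicE mem_set ?mulr1.
rewrite indicE memNset ?mulr0// cellE -truncn_eq// => /eqP h.
by move: aN; rewrite -(inj_eq val_inj)/= h eqxx.
Qed.

Lemma step_outside c t : ~~ (u - C%:R <= t < u + C%:R) -> step c t = 0.
Proof.
move=> /negP tN; apply: big1 => a _; rewrite indicE memNset ?mulr0// cellE.
move=> /andP[h1 h2]; apply: tN; apply/andP; split.
  have : 0 <= (t - u + C%:R) * k%:R by apply: le_trans h1.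
  by rewrite pmulr_lge0//; lra.
have : (t - u + C%:R) * k%:R < C.*2%:R * k%:R.
  by rewrite (lt_le_trans h2)// -natrM -doubleMl ler_nat.
by rewrite ltr_pM2r// -muln2 natrM; lra.
Qed.

Lemma measurable_step c : measurable_fun setT (step c).
Proof.
apply: measurable_sum => a; apply: measurable_funM => //.
exact: measurable_indic (measurable_cell a).
Qed.

Lemma integral_step c : (forall a, 0 <= c a) ->
  (\int[lebesgue_measure]_t (step c t)%:E)%E =
  (k%:R^-1 * \sum_(a < (C * k).*2) c a)%:E.
Proof.
move=> c0; under eq_integral do rewrite -sumEFin.
rewrite ge0_integral_sum//; last 2 first.
- move=> a; apply/measurable_EFinP; apply: measurable_funM => //.
  exact: measurable_indic (measurable_cell a).
- by move=> a t _; rewrite lee_fin mulr_ge0// indicE.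
rewrite mulr_sumr -sumEFin; apply: eq_bigr => a _.
under eq_integral do rewrite EFinM.
rewrite ge0_integralZl//; last 2 first.
- apply/measurable_EFinP; exact: measurable_indic (measurable_cell a).
- by rewrite lee_fin.
rewrite integral_indic//; last exact: measurable_cell.
rewrite setIT; transitivity ((c a)%:E * (k%:R^-1)%:E)%E; last first.
  by rewrite -EFinM mulrC.
by congr (_ * _)%E; exact: lebesgue_measure_cell.
Qed.

End StepFunction.

(** * Convergence of grid counts to the volume *)

Section Volume.
Context {R : realType}.

Lemma lebesgue_volume0 d : lebesgue_volume (set0 : set 'rV[R]_d) = 0%E.
Proof.
elim: d => [|d IH] /=; first by rewrite indicE in_set0.
by under eq_integral do rewrite IH; rewrite integral0.
Qed.

Lemma measurable_fun_countable (D : set R) (f : R -> \bar R) :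
  countable D -> measurable_fun D f.
Proof.
move=> cD _ Y _; apply: countable_measurable; first exact: measurable_set1.
by apply: sub_countable cD; apply: subset_card_le; exact: subIsetl.
Qed.

(* The right-hand sides vary with [n] so that the induction on [d] applies to
   the slices through the grid hyperplanes next to [t], which converge to the
   slice at [t]. The last hypothesis excludes a constraint [0 <= b i] whose
   truth value is not stable in the limit; for the slices it fails only for
   finitely many [t]. *)
Lemma grid_count_cvg d (I : finType) (A : I -> 'cV[R]_d) (b : I -> R)
    (bs : nat -> I -> R) (u : 'rV[R]_d) (C : nat) (k : nat -> nat) :
  (forall n, 0 < k n)%N -> (k n)%:R^-1 @[n --> \oo] --> (0 : R) ->
  (forall i, bs n i @[n --> \oo] --> b i) -> (forall i, A i = 0 -> b i != 0) ->
  (grid_count u (k n) C (polyhedron A (bs n)))%:E @[n --> \oo] -->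
    lebesgue_volume (polyhedron A b `&` box u C).
Proof.
move=> k0 kV; elim: d => [|d IH] in A b bs u *.
  move=> bsb Ab.
  (* In dimension 0 a constraint reads [0 <= b i]; since [b i != 0], it eventually has the same
     truth value as [0 <= bs n i]. *)
  rewrite /=; apply: cvg_near_cst.
  have ev : \forall n \near \oo, forall i, (0 <= bs n i) = (0 <= b i).
    apply: filter_forall => i.
    have := Ab i (flatmx0 _); rewrite neq_lt => /orP[bi|bi].
      apply: (filterS _ (cvgr_lt _ (bsb i) _ bi)) => n h.
      by rewrite !leNgt h bi.
    apply: (filterS _ (cvgr_gt _ (bsb i) _ bi)) => n h.
    by rewrite (ltW h) (ltW bi).
  near=> n.
  have evn : forall i, (0 <= bs n i) = (0 <= b i) by near: n.
  rewrite /grid_count expr0 divr1; congr (_%:E).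
  rewrite (eq_bigr (fun=> \1_(polyhedron A b `&` box u C) 0)); last first.
    move=> v _; rewrite !indicE; congr (nat_of_bool _)%:R.
    apply/asbool_equiv_eq => /=; rewrite thinmx0; split=> [H|[H _]].
      by split=> [i|[]//]; have := H i; rewrite mul0mx mxE evn.
    by move=> i; have := H i; rewrite mul0mx mxE evn.
  by rewrite sumr_const card_mx muln0 expn0.
move=> bsb Ab; rewrite /=.
pose u0 := lsubmx (u : 'rV_(1 + d)) 0 0; pose u' := rsubmx (u : 'rV_(1 + d)).
pose A0 i := usubmx (A i : 'cV_(1 + d)) 0 0.
pose A' i := dsubmx (A i : 'cV_(1 + d)).
pose c n a := grid_count u' (k n) C
  (polyhedron A' (fun i => bs n i - grid_point u0 (k n) C a * A0 i)).
pose f_ n t := (step u0 (k n) C (c n) t)%:E.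
pose f t := lebesgue_volume
  [set v : 'rV[R]_d | (polyhedron A b `&` box u C) (row_mx (t%:M : 'rV[R]_1) v)].
have -> : (fun n => (grid_count u (k n) C (polyhedron A (bs n)))%:E) =
          (fun n => \int[lebesgue_measure]_t f_ n t)%E.
  apply/funext => n; rewrite integral_step// => [|a]; last exact: grid_count_ge0.
  rewrite (grid_countS (u : 'rV_(1 + d))); congr ((_ * _)%:E).
  by apply: eq_bigr => a _; rewrite polyhedron_slice.
(* For [t] outside [bad], every constraint of the slice with zero linear part has a nonzero
   right-hand side, as the induction hypothesis requires. Being countable, [bad] is negligible. *)
pose bad := [set t | exists2 i, A0 i != 0 & t = b i / A0 i].
have bad_countable : countable bad.
  apply: (@sub_countable _ _ _ [set: I]); last exact: finite_set_countable.
  apply: (@card_le_trans _ _ _ ((fun i => b i / A0 i) @` [set: I])).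
    by apply: subset_card_le => t [i _ ->]; exists i.
  exact: card_image_le.
have f_f t : ~ bad t -> f_ n t @[n --> \oo] --> f t.
  move=> tN.
  have [tC|tC] := boolP (u0 - C%:R <= t < u0 + C%:R); last first.
    rewrite /f_; under eq_fun do rewrite step_outside//.
    rewrite /f (_ : [set v | _] = set0) ?lebesgue_volume0; first exact: cvg_cst.
    by apply/seteqP; split => // v [_ /(box_slice (u : 'rV_(1 + d)))[/negPf]];
       rewrite -/u0 (negbTE tC).
  (* [a n] is the cell containing [t]; its grid point lies within [1 / k n] of [t], hence the
     right-hand sides converge to those of the slice at [t]. *)
  have /choice[a aP] : forall n, exists a : nat,
      [/\ step u0 (k n) C (c n) t = c n a, grid_point u0 (k n) C a <= t,
          t < grid_point u0 (k n) C a + (k n)%:R^-1 & (a < (C * k n).*2)%N].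
    by move=> n; exact: step_inside.
  rewrite /f_; under eq_fun do rewrite (let: And4 h _ _ _ := aP _ in h).
  rewrite /f (_ : [set v | _] =
    polyhedron A' (fun i => b i - t * A0 i) `&` box u' C); last first.
    rewrite -polyhedron_slice; apply/seteqP; split=> v [h1 h2]; split=> //.
      by have /(box_slice (u : 'rV_(1 + d)))[] := h2.
    by apply/(box_slice (u : 'rV_(1 + d))).
  apply: IH => [i|i A'i0]; last first.
    have [A0i|A0i] := eqVneq (A0 i) 0.
      rewrite A0i mulr0 subr0; apply: Ab.
      have Au0 : usubmx (A i : 'cV_(1 + d)) = 0.
        by apply/matrixP => x y; rewrite !ord1 [RHS]mxE.
      by rewrite -[A i](@vsubmxK _ 1 d) Au0 [dsubmx _]A'i0 col_mx0.
    rewrite subr_eq0; apply/eqP => h; apply: tN; exists i => //.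
    by rewrite h mulfK.
  apply: cvgB => //; apply: cvgMl.
  apply: (@squeeze_cvgr _ _ _ _ (fun n => t - (k n)%:R^-1) (cst t)).
  - by near=> n; have [_ h1 h2 _] := aP n; rewrite h1 andbT lerBlDr ltW.
  - by rewrite -[X in _ --> X]subr0; apply: cvgB => //; exact: cvg_cst.
  - exact: cvg_cst.
have mf_ n : measurable_fun setT (f_ n).
  by apply/measurable_EFinP; exact: measurable_step.
have mbad : measurable bad.
  exact: (countable_measurable (@measurable_set1 R)).
have mf : measurable_fun setT f.
  rewrite -(setvU bad); apply/measurable_funU => //.
    exact: measurableC.
  split; last exact: measurable_fun_countable.
  apply: (emeasurable_fun_cvg f_) => [n|t /f_f//].
  exact: measurable_funS (mf_ n).
(* The bound [(2 C)^d] on the slices is uniform in [n], and the step functions vanish outside the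
   box: this is the integrable majorant for dominated convergence. *)
have D01 n t : (`|f_ n t| <= ((C.*2)%:R ^+ d)%:E *
    (\1_[set` `[(u0 - C%:R), (u0 + C%:R)[] t)%:E)%E.
  have [tC|tC] := boolP (u0 - C%:R <= t < u0 + C%:R); last first.
    rewrite /f_ step_outside// abse0 mule_ge0// lee_fin ?indicE ?exprn_ge0//.
  have [a [h _ _ _]] := step_inside (k0 n) (c n) tC.
  rewrite /f_ h indicE mem_set ?mule1 /= ?in_itv// lee_fin.
  by rewrite ger0_norm ?grid_count_ge0// grid_count_le.
pose g (t : R) : \bar R := (((C.*2)%:R ^+ d)%:E *
    (\1_[set` `[(u0 - C%:R), (u0 + C%:R)[] t)%:E)%E.
have [|||_ _ ] := @dominated_convergence _ _ R lebesgue_measure setT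
  measurableT f_ f g mf_ mf.
- exists bad; split => //; first exact: countable_lebesgue_measure0.
  by move=> t; apply: contra_notP => /f_f h _.
- apply: integrableZl => //; exact: integrable_indic_itv.
- by apply: aeW => t n _; exact: D01.
exact.
Unshelve. all: by end_near.
Qed.
End Volume.

(** * Relative volume of a slice of a cone *)

Section Cardinality.

(** When [A] is infinite, so is its image, and both sides are 0 by the convention on [fset_set]. *)
Lemma card_fset_set_image (T U : choiceType) (f : T -> U) (A : set T) :
  {in A &, injective f} -> #|` fset_set (f @` A)|%fset = #|` fset_set A|%fset.
Proof.
move=> f_inj; have [fA|nfA] := pselect (finite_set A).
  rewrite fset_set_image// card_in_imfset//= => x y.
  by rewrite !in_fset_set//; exact: f_inj.
have nfA' : ~ finite_set (f @` A).
  by rewrite (eq_finite_set (inj_card_eq f_inj)).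
by rewrite /fset_set; case: pselect => //; case: pselect.
Qed.

Lemma card_fset_set_finset (T : finType) (U : choiceType) (f : T -> U)
    (A : {set T}) : injective f ->
  #|` fset_set (f @` [set x | x \in A])|%fset = #|A|.
Proof.
move=> f_inj; rewrite card_fset_set_image; last by move=> x y _ _; exact: f_inj.
have -> : fset_set [set x | x \in A] = seq_fset tt (enum A).
  apply/fsetP => x; rewrite seq_fsetE mem_enum in_fset_set.
    by apply/idP/idP; [rewrite inE|move=> ?; rewrite inE].
  exact: finite_finset.
by rewrite size_seq_fset undup_id ?enum_uniq// -cardE.
Qed.
End Cardinality.

Section Pairing.
Context {R : realType} {n : nat}.
Implicit Types (x y : 'rV[R]_n) (v w : 'cV[R]_n).

Lemma pairDl x y v : ((x + y) *m v) 0 0 = (x *m v) 0 0 + (y *m v) 0 0.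
Proof. by rewrite mulmxDl mxE. Qed.

Lemma pairNl x v : ((- x) *m v) 0 0 = - (x *m v) 0 0.
Proof. by rewrite mulNmx mxE. Qed.

Lemma pairZl a x v : ((a *: x) *m v) 0 0 = a * (x *m v) 0 0.
Proof. by rewrite -scalemxAl mxE. Qed.

Lemma pairDr x v w : (x *m (v + w)) 0 0 = (x *m v) 0 0 + (x *m w) 0 0.
Proof. by rewrite mulmxDr mxE. Qed.

Lemma pairNr x v : (x *m (- v)) 0 0 = - (x *m v) 0 0.
Proof. by rewrite mulmxN mxE. Qed.

End Pairing.

(** * Slices of a polyhedral cone by an integral hyperplane *)

Section ConeSlice.
Context {R : realType} {n : nat} {I : finType}.
Variables (h : 'cV[R]_n.+1) (j0 : 'I_n.+1) (L : I -> 'cV[R]_n.+1).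
Variable c : 'rV[R]_n.+1.
Hypothesis h_int : forall j, h j 0 \is a Num.int.
Hypothesis h_pivot : h j0 0 = 1.
Hypothesis c_h : (c *m h) 0 0 = 1.
Hypothesis c_interior : forall i, 0 < (c *m L i) 0 0.

Definition slice : set 'rV[R]_n.+1 :=
  [set x | (x *m h) 0 0 = 1 /\ forall i, 0 <= (x *m L i) 0 0].

(** From the interior point [c], a short step towards any [x] of the hyperplane stays in the slice,
    and [x] is an affine combination of [c] and the point reached. *)
Lemma affine_span_slice : affine_span slice = [set x | (x *m h) 0 0 = 1].
Proof.
apply/seteqP; split => x /=.
  move=> [k [w [v [Pv w1 ->]]]]; rewrite mulmx_suml summxE -w1.
  apply: eq_bigr => i _; rewrite -scalemxAl mxE.
  by have [-> _] := Pv i; rewrite mulr1.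
move=> xh.
pose D i := ((x - c) *m L i) 0 0.
have DE i : (x *m L i) 0 0 = (c *m L i) 0 0 + D i.
  by rewrite /D pairDl pairNl addrCA subrr addr0.
(* [K] dominates every ratio [|D i| / (c *m L i) 0 0], so the step [(x - c) / K] violates no
   inequality. *)
pose K := 1 + \sum_i `|D i| / (c *m L i) 0 0.
have s0 i : 0 <= `|D i| / (c *m L i) 0 0 by rewrite divr_ge0// ltW.
have K0 : 0 < K by rewrite ltr_pwDl// sumr_ge0.
have Kn0 : K != 0 by rewrite gt_eqF.
pose y := c + K^-1 *: (x - c).
have Py : slice y.
  split; first by rewrite !(pairDl, pairZl, pairNl) xh c_h; ring.
  move=> i; rewrite pairDl pairZl -/(D i).
  have : `|D i| <= K * (c *m L i) 0 0.
    rewrite -ler_pdivrMr// /K (bigD1 i)//= addrCA lerDl addr_ge0// sumr_ge0//.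
  rewrite ler_norml => /andP[h1 _].
  rewrite -(pmulr_rge0 _ K0) mulrDr mulrA divff// mul1r; lra.
have Pc : slice c by split => // i; exact: ltW.
exists 2%N, (fun i => if i == 0 then K else 1 - K).
exists (fun i => if i == 0 then y else c); split => [i||].
- by case: ifP.
- by rewrite big_ord_recl big_ord1 /=; ring.
- rewrite big_ord_recl big_ord1 /= /y scalerDr scalerA divff// scale1r scalerBl.
  by rewrite scale1r addrC addrA subrK addrCA subrr addr0.
Qed.

Lemma direction_slice : direction slice = [set x | (x *m h) 0 0 = 0].
Proof.
rewrite /direction affine_span_slice; apply/seteqP; split => x /=.
  by move=> [y [z [/= yh zh ->]]]; rewrite pairDl pairNl yh zh subrr.
move=> xh; exists (x + c), c; split => //; last by rewrite addrK.
by rewrite /= pairDl xh c_h add0r.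
Qed.

(** Since [h] has coefficient 1 at [j0], the equation [h = 0] expresses coordinate [j0] through the
    others with integer coefficients. The basis vectors are [e_l - h_l e_j0] for [l != j0]. *)
Lemma lattice_basis_exists : exists B : 'M[R]_(n, n.+1),
  lattice_basis (direction slice) B.
Proof.
pose B : 'M[R]_(n, n.+1) := \matrix_(i, j)
  ((j == lift j0 i)%:R - h (lift j0 i) 0 * (j == j0)%:R).
have Bl (t : 'rV[R]_n) i : (t *m B) 0 (lift j0 i) = t 0 i.
  rewrite mxE (bigD1 i)//= big1 => [|l li].
    by rewrite mxE eqxx (eq_sym _ j0) (negbTE (neq_lift _ _)) mulr0 subr0 mulr1 addr0.
  rewrite mxE (eq_sym _ j0) (negbTE (neq_lift _ _)) (inj_eq lift_inj) eq_sym.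
  by rewrite (negbTE li) mulr0 subr0 mulr0.
have hE (x : 'rV[R]_n.+1) :
    (x *m h) 0 0 = x 0 j0 + \sum_i x 0 (lift j0 i) * h (lift j0 i) 0.
  by rewrite mxE (bigD1_ord j0)//= h_pivot mulr1.
have Bh (t : 'rV[R]_n) : (t *m B *m h) 0 0 = 0.
  rewrite hE; under eq_bigr do rewrite Bl.
  rewrite mxE -big_split big1// => i _ /=.
  by rewrite mxE (negbTE (neq_lift _ _)) eqxx mulr1 sub0r mulrN addNr.
have kerE (x : 'rV[R]_n.+1) : (x *m h) 0 0 = 0 ->
    x = (\row_i x 0 (lift j0 i)) *m B.
  move=> xh; apply/matrixP => i j; rewrite ord1.
  have [j' ->|->] := unliftP j0 j; first by rewrite Bl mxE.
  have := Bh (\row_i x 0 (lift j0 i)); rewrite -[RHS]xh !hE.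
  under eq_bigr do rewrite Bl mxE.
  by move=> /addIr ->.
exists B; rewrite direction_slice; split.
- apply/row_freeP; exists (\matrix_(j, i) (j == lift j0 i)%:R).
  apply/row_matrixP => i; rewrite row_mul; apply/rowP => l.
  rewrite mxE (bigD1 (lift j0 l))//= big1 => [|j jl]; last first.
    by rewrite [X in _ * X]mxE (negbTE jl) mulr0.
  by rewrite addr0 [X in _ * X]mxE eqxx mulr1 rowE Bl !mxE eqxx eq_sym.
- apply/seteqP; split => x /=; first by move=> /kerE ->; eexists.
  by move=> [t _ <-].
- apply/seteqP; split => x /=.
    move=> [xh xi]; exists (\row_i x 0 (lift j0 i)); last by rewrite -kerE.
    by apply/mxOverP => i j; rewrite mxE; apply/mxOverP.
  move=> [z zi <-]; split => //; apply: mxOverM => //.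
  by apply/mxOverP => i j; rewrite mxE rpredB// ?rpredM// ?natr_int//.
Qed.

Lemma lattice_basis_dim d (B : 'M[R]_(d, n.+1)) :
  lattice_basis (direction slice) B -> d = n.
Proof.
rewrite direction_slice => -[Bf Bker _].
have hn0 : h != 0.
  by apply: contraPneq h_pivot => ->; rewrite mxE => /eqP; rewrite eq_sym oner_eq0.
have rh : \rank h = 1%N.
  by apply/eqP; rewrite eqn_leq rank_leq_col lt0n mxrank_eq0//.
have kerP (x : 'rV[R]_n.+1) : (x *m h) 0 0 = 0 -> x *m h = 0.
  by move=> xh; apply/matrixP => i j; rewrite !ord1 xh mxE.
have BK : (B <= kermx h)%MS.
  apply/row_subP => i; apply/sub_kermxP/kerP.
  have : [set x | (x *m h) 0 0 = 0] (row i B) by rewrite Bker rowE; eexists.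
  by [].
have KB : (kermx h <= B)%MS.
  apply/row_subP => i.
  have : [set x : 'rV[R]_n.+1 | (x *m h) 0 0 = 0] (row i (kermx h)).
    by rewrite /= -row_mul mulmx_ker row0 mxE.
  by rewrite Bker => -[t _ <-]; exact: submxMl.
have : \rank B = \rank (kermx h) by apply/eqP; rewrite eqn_leq !mxrankS.
by rewrite mxrank_ker rh subn1 /=; move: Bf => /eqP ->.
Qed.

Variables (w : I -> R) (k : nat -> nat) (r : R).
Hypothesis slice_bounded : forall x, slice x -> forall j, `|x 0 j| <= 1.
Hypothesis k_gt0 : forall q, (0 < k q)%N.
Hypothesis k_infty : (k q)%:R^-1 @[q --> \oo] --> (0 : R).

(** The facets are displaced by the constants [w i], which become [w i / q] after division by [q]
    and vanish in the limit. *)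
Definition lattice_points (q : nat) : set 'rV[R]_n.+1 :=
  [set x | [/\ x \is a mxOver Num.int, (x *m h) 0 0 = q%:R
     & forall i, w i <= (x *m L i) 0 0]].

Hypothesis lattice_points_bounded : forall q x, lattice_points (k q) x ->
  forall j, `|x 0 j| <= (k q)%:R.
Hypothesis count_cvg :
  #|` fset_set (lattice_points (k q))|%fset%:R / (k q)%:R ^+ n @[q --> \oo] --> r.

(** In the coordinates [t], the lattice points divided by [k q] are exactly the grid points of a
    polyhedron whose right-hand sides tend to those of the slice. Their normalized count tends both
    to the volume and to [r], whatever [p] and [B]. *)
Lemma volume_slice_coordinates (p : 'rV[R]_n.+1) (B : 'M[R]_(n, n.+1)) :
  affine_span slice p -> lattice_basis (direction slice) B ->
  lebesgue_volume [set t : 'rV[R]_n | slice (p + t *m B)] = r%:E.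
Proof.
rewrite affine_span_slice direction_slice => /= ph [Bfree Bker Bint].
have Bh (t : 'rV[R]_n) : (t *m B *m h) 0 0 = 0.
  suff: [set x | (x *m h) 0 0 = 0] (t *m B) by [].
  by rewrite Bker; exists t.
(* [e] is an integer point of the hyperplane, whereas [p] need not be integral. Centring the grid at
   the coordinates [u] of [e] turns the grid points into the points [e + (z / k q) B] with [z]
   integral. *)
pose e : 'rV[R]_n.+1 := delta_mx 0 j0.
have eh : (e *m h) 0 0 = 1 by rewrite -rowE mxE.
have e_int : e \is a mxOver Num.int.
  by apply/mxOverP => i j; rewrite mxE natr_int.
have [u uB] : exists u : 'rV[R]_n, u *m B = e - p.
  have : [set x | (x *m h) 0 0 = 0] (e - p) by rewrite /= pairDl pairNl eh ph subrr.
  by rewrite Bker => -[u _ uB]; exists u.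
(* The right inverse [B'] recovers [t] from [p + t *m B]. Hence a single box of radius [C] around
   [u] contains the slice and all the rescaled lattice points. *)
have [B' BB'] : exists B', B *m B' = 1%:M by apply/row_freeP.
pose M : R := \sum_l (`|u 0 l| + \sum_j (1 + `|p 0 j|) * `|B' j l|).
pose C := (Num.truncn M).+1.
have MC : M < C%:R by exact: truncnS_gt.
have coord_bound (t : 'rV[R]_n) l :
    (forall j, `|(p + t *m B) 0 j| <= 1) -> `|t 0 l - u 0 l| < C%:R.
  move=> pt; apply: le_lt_trans MC.
  have -> : t = (p + t *m B - p) *m B'.
    by rewrite addrC addKr -mulmxA BB' mulmx1.
  rewrite /M (bigD1 l)//= -[leLHS]addr0; apply: lerD; last first.
    apply: sumr_ge0 => l' _; apply: addr_ge0 => //; apply: sumr_ge0 => j _.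
    by apply: mulr_ge0 => //; apply: addr_ge0.
  apply: (le_trans (ler_normB _ _)); rewrite addrC lerD2l mxE.
  apply: (le_trans (ler_norm_sum _ _ _)); apply: ler_sum => j _.
  rewrite normrM ler_wpM2r// mxE [(- p) _ _]mxE.
  by apply: (le_trans (ler_normB _ _)); rewrite lerD2r.
pose A i := - (B *m L i).
pose b i := (p *m L i) 0 0.
pose bs q i := b i - w i / (k q)%:R.
have AE (t : 'rV[R]_n) i : (t *m A i) 0 0 = - ((t *m B) *m L i) 0 0.
  by rewrite /A mulmxN mxE mulmxA.
have sliceE : [set t : 'rV[R]_n | slice (p + t *m B)] =
    polyhedron A b `&` box u C.
  apply/seteqP; split => t /=.
    move=> Pt; split => [i|l].
      by have [_ /(_ i)] := Pt; rewrite AE pairDl /b; lra.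
    have := coord_bound t l (slice_bounded Pt).
    by rewrite ltr_norml; lra.
  move=> [tA _]; split; first by rewrite pairDl ph Bh addr0.
  by move=> i; have := tA i; rewrite AE pairDl /b; lra.
have bsb i : bs q i @[q --> \oo] --> b i.
  rewrite -[X in _ --> X]subr0 -(mulr0 (w i)); apply: cvgB; first exact: cvg_cst.
  by apply: cvgMr.
(* If [A i = 0], then [L i] is constant on the hyperplane, equal to its positive value at [c]. *)
have Ab i : A i = 0 -> b i != 0.
  move=> Ai0; apply: lt0r_neq0; have := c_interior i.
  have : [set x | (x *m h) 0 0 = 0] (c - p) by rewrite /= pairDl pairNl c_h ph subrr.
  rewrite Bker => -[t _ tB]; rewrite -(subrK p c) -tB pairDl.
  have := AE t i; rewrite Ai0 mulmx0 mxE /b => /esym/eqP.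
  by rewrite oppr_eq0 => /eqP ->; rewrite add0r.
have main := grid_count_cvg (u := u) (C := C) k_gt0 k_infty bsb Ab.
have kn0 q : (k q)%:R != 0 :> R by rewrite pnatr_eq0 -lt0n.
have kq0 q : 0 < (k q)%:R :> R by rewrite ltr0n.
have countE q : grid_count u (k q) C (polyhedron A (bs q)) =
    #|` fset_set (lattice_points (k q))|%fset%:R / (k q)%:R ^+ n.
  rewrite /grid_count; congr (_ / _).
  pose F := [set v : 'rV['I_(C * k q).*2]_n |
    grid_vec u v \in polyhedron A (bs q)]%SET.
  (* [psi v] is the grid point of index [v] scaled by [k q]; [psi] matches the grid points of the
     polyhedron with the lattice points. *)
  pose zvec (v : 'rV['I_(C * k q).*2]_n) : 'rV[R]_n :=
    \row_l ((v 0 l)%:R - (C * k q)%:R).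
  pose psi v := (k q)%:R *: e + zvec v *m B.
  have gridE v : p + grid_vec u v *m B = (k q)%:R^-1 *: psi v.
    rewrite /psi scalerDr scalerA mulVf// scale1r scalemxAl.
    have -> : grid_vec u v = u + (k q)%:R^-1 *: zvec v.
      by apply/rowP => l; rewrite !mxE mulrC.
    by rewrite mulmxDl uB addrA [p + _]addrC subrK.
  have psi_inj : injective psi.
    move=> v v' /addrI /(congr1 (mulmx^~ B')); rewrite -!mulmxA BB' !mulmx1.
    move=> /rowP vv'; apply/rowP => l; apply: val_inj; have := vv' l.
    by rewrite !mxE => /addIr/eqP; rewrite eqr_nat => /eqP.
  have polyE (t : 'rV[R]_n) x : p + t *m B = (k q)%:R^-1 *: x ->
      polyhedron A (bs q) t <-> forall i, w i <= (x *m L i) 0 0.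
    move=> tx.
    have H i : (t *m A i) 0 0 <= bs q i = (w i <= (x *m L i) 0 0).
      rewrite AE /bs /b -subr_ge0 addrAC opprK -pairDl tx pairZl subr_ge0.
      by rewrite mulrC ler_pM2l// invr_gt0.
    by split=> H0 i; have := H0 i; rewrite H.
  have -> : lattice_points (k q) = psi @` [set v | v \in F].
    apply/seteqP; split => x /=.
      move=> xL; have [x_int xh xw] := xL.
      have : ([set y | (y *m h) 0 0 = 0] `&` [set y | y \is a mxOver Num.int])
          (x - (k q)%:R *: e).
        split; first by rewrite /= pairDl pairNl pairZl xh eh mulr1 subrr.
        apply/mxOverP => i j; rewrite /= !mxE rpredB//; first exact/mxOverP.
        by rewrite rpredM ?natr_int.
      rewrite Bint => -[z /= z_int zB].
      pose t := u + (k q)%:R^-1 *: z.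
      have tx : p + t *m B = (k q)%:R^-1 *: x.
        by rewrite -[x](subrK ((k q)%:R *: e)) -zB scalerDr scalerA mulVf// scale1r
          /t mulmxDl uB -scalemxAl addrA [p + _]addrC subrK addrC.
      (* The strict bound [|z_l| < C k q] puts each integer coordinate in the range of the grid
         indices. *)
      have /fin_all_exists[a aP] : forall l, exists a : 'I_(C * k q).*2,
          z 0 l = a%:R - (C * k q)%:R.
        move=> l.
        have : `|t 0 l - u 0 l| < C%:R.
          apply: coord_bound => j; rewrite tx mxE normrM ger0_norm ?invr_ge0//.
          by rewrite mulrC ler_pdivrMr// mul1r lattice_points_bounded.
        rewrite !mxE addrAC subrr add0r normrM ger0_norm ?invr_ge0// mulrC.
        rewrite ltr_pdivrMr// -natrM ltr_norml => /andP[z1 z2].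
        have : z 0 l + (C * k q)%:R \is a Num.nat.
          rewrite natrEint rpredD ?natr_int//=; last by apply/mxOverP.
          lra.
        move=> /natrP[a za].
        have aC : (a < (C * k q).*2)%N.
          by rewrite -(ltr_nat R) -za -addnn natrD; lra.
        by exists (Ordinal aC) => /=; rewrite -za addrK.
      pose v := \row_l a l.
      have zv : zvec v = z by apply/rowP => l; rewrite !mxE aP.
      have vx : psi v = x by rewrite /psi zv zB addrC subrK.
      exists v => //; rewrite inE; apply/mem_set/(polyE _ x) => //.
      by rewrite gridE vx.
    move=> [v]; rewrite inE => /set_mem vP <-.
    split.
    - apply/mxOverP => i j; rewrite [psi v]/psi mxE rpredD//.
        by rewrite !mxE rpredM ?natr_int.
      apply/mxOverP.
      have : [set z *m B | z in [set z : 'rV[R]_n | z \is a mxOver Num.int]]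
          (zvec v *m B).
        exists (zvec v) => //=; apply/mxOverP => i' j'.
        by rewrite mxE rpredB ?natr_int.
      by rewrite -Bint => -[].
    - by rewrite pairDl pairZl eh Bh addr0 mulr1.
    - by apply/(polyE _ _ (gridE v)).
  rewrite card_fset_set_finset// -sum1_card natr_sum [RHS]big_mkcond/=.
  by apply: eq_bigr => v _; rewrite indicE inE; case: (_ \in _).
have main' : (grid_count u (k q) C (polyhedron A (bs q)))%:E @[q --> \oo] -->
    r%:E.
  under eq_fun do rewrite countE.
  by apply: cvg_EFin => //; near=> q.
by rewrite sliceE; exact: (cvg_unique (@ereal_hausdorff R) main main').
Unshelve. all: by end_near.
Qed.

(** A lattice basis exists, and every admissible base point and basis give [r], so the choice made
    by [xget] is forced. *)
Theorem relative_volume_slice : relative_volume slice = r%:E.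
Proof.
apply: xget_unique.
  have [B HB] := lattice_basis_exists.
  exists n, c, B; split => //; first by rewrite affine_span_slice.
  by rewrite volume_slice_coordinates// affine_span_slice.
move=> y [d [p [B [Pp HB ->]]]].
have dn := lattice_basis_dim HB; subst d.
by rewrite volume_slice_coordinates.
Qed.

End ConeSlice.

(** * Quasipolynomials and Kunz coordinates *)

Section Limits.
Context {R : realType}.

Lemma inv_nat_cvg0 (k : nat -> nat) : (forall q, q < k q)%N ->
  (k q)%:R^-1 @[q --> \oo] --> (0 : R).
Proof.
move=> kq; apply: (@squeeze_cvgr _ _ _ _ (cst 0) (@harmonic R)).
- near=> q; rewrite invr_ge0 ler0n /= lef_pV2 ?posrE ?ltr0n// ?ler_nat//.
  exact: leq_ltn_trans (kq q).
- exact: cvg_cst.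
- exact: cvg_harmonic.
Unshelve. all: by end_near.
Qed.

Lemma periodic_bounded (f : nat -> R) : Defs.periodic f ->
  exists M, forall n, `|f n| <= M.
Proof.
move=> [N N0 fN].
have fE n a : f (a + n * N)%N = f a.
  by elim: n => [|n IH]; rewrite ?addn0// mulSn addnCA addnC fN.
exists (\sum_(a < N) `|f a|) => n; rewrite (divn_eq n N) addnC fE.
by rewrite (bigD1 (Ordinal (ltn_pmod n N0)))//= lerDl sumr_ge0.
Qed.

(** Periodic coefficients are bounded, so after division by the [d]-th power each term of lower
    degree is [O(1 / k q)]. *)
Lemma quasipolynomial_cvg d (l : R) p (k : nat -> nat) :
  quasipolynomial d l p -> (forall q, q < k q)%N ->
  p (k q) / (k q)%:R ^+ d @[q --> \oo] --> l.
Proof.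
move=> [c [cper pE cl _]] kq.
have k0 q : 0 < (k q)%:R :> R by rewrite ltr0n (leq_ltn_trans _ (kq q)).
have -> : (fun q => p (k q) / (k q)%:R ^+ d) = (fun q =>
    \sum_(i < d) c (widen_ord (leqnSn d) i) (k q) * (k q)%:R ^+ i / (k q)%:R ^+ d
    + l).
  apply/funext => q; rewrite pE big_ord_recr /= mulrDl mulr_suml cl mulfK//.
  by rewrite expf_neq0 ?gt_eqF.
rewrite -[X in _ --> X]add0r; apply: cvgD; last exact: cvg_cst.
have /fin_all_exists[M cM] : forall i : 'I_d, exists M,
    forall n, `|c (widen_ord (leqnSn d) i) n| <= M.
  by move=> i; exact: periodic_bounded (cper _).
apply: norm_cvg0.
apply: (@squeeze_cvgr _ _ _ _ (cst 0) (fun q => (\sum_i M i) * (k q)%:R^-1)).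
- near=> q; rewrite normr_ge0 /= mulr_suml.
  apply: (le_trans (ler_norm_sum _ _ _)); apply: ler_sum => i _.
  rewrite -mulrA normrM; apply: ler_pM => //.
  rewrite ger0_norm; last by rewrite divr_ge0// exprn_ge0.
  rewrite ler_pdivrMr ?exprn_gt0//.
  rewrite mulrC ler_pdivlMr// -exprSr ler_weXn2l//.
  by rewrite ler1n -(ltr0n R).
- exact: cvg_cst.
- rewrite -[X in _ --> X](mulr0 (\sum_i M i)).
  by apply: cvgMr; exact: inv_nat_cvg0.
Unshelve. all: by end_near.
Qed.

(** If [F] is minimal at [a], then [F a <= F (2 a) <= 2 F a] with [2 a] taken modulo [m], whence
    [0 <= F a]. The case [2 a = m] escapes this argument and is a hypothesis. *)
Lemma subadditive_ge0 (m : nat) (F : nat -> R) :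
  (forall a b : nat, (0 < a < m)%N -> (0 < b < m)%N -> ((a + b) %% m != 0)%N ->
     F ((a + b) %% m)%N <= F a + F b) ->
  (forall a : nat, (0 < a < m)%N -> (a + a = m)%N -> 0 <= F a) ->
  forall a, (0 < a < m)%N -> 0 <= F a.
Proof.
move=> Fadd Fhalf; case: m => [|[|n]] in Fadd Fhalf *; [by case|by case=> [|[]]|].
have [i0 _ i0P] := arg_minP (fun i : 'I_n.+1 => F i.+1) (erefl true : xpredT ord0).
suff F0 : 0 <= F i0.+1.
  move=> [//|a] /= an; apply: le_trans F0 _.
  by have := i0P (Ordinal (an : a < n.+1)%N) isT.
have i0n : (0 < i0.+1 < n.+2)%N by rewrite /= ltnS.
have [h|h] := eqVneq (i0.+1 + i0.+1)%N n.+2; first exact: Fhalf.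
have n0 : ((i0.+1 + i0.+1) %% n.+2 != 0)%N.
  apply/negP => /dvdnP[[|[|k]] E]; move: h (ltn_ord i0) (E); rewrite ?mulSn; lia.
have := Fadd _ _ i0n i0n n0.
have lt : (((i0.+1 + i0.+1) %% n.+2).-1 < n.+1)%N.
  by rewrite -ltnS prednK ?lt0n ?ltn_mod.
have := i0P (Ordinal lt) isT; rewrite /= prednK ?lt0n//.
lra.
Qed.

End Limits.

(** * Kunz coordinates of the semigroups containing [m] *)

Section Kunz.
Variable m : nat.
Hypothesis m_gt0 : (0 < m)%N.

(* [f i] is the Kunz coordinate of the residue class [i]: the least element of
   the class in the semigroup is [f i * m + i]. *)
Definition kunz_set (f : nat -> nat) : set nat :=
  [set s | f (s %% m) <= s %/ m]%N.

(** The last summand is the carry of [i + j]; the inequalities express that [kunz_set f] is closed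
    under addition. *)
Definition kunz (f : nat -> nat) : Prop := f 0%N = 0%N /\
  forall i j, (i < m)%N -> (j < m)%N ->
    (f ((i + j) %% m) <= f i + f j + (m <= i + j))%N.

Lemma kunz_setMD f x i : (i < m)%N -> kunz_set f (x * m + i)%N = (f i <= x)%N.
Proof.
by move=> im; rewrite /kunz_set /= modnMDl modn_small// divnMDl// divn_small// addn0.
Qed.

Lemma eq_kunz_set f g : (forall i, (i < m)%N -> f i = g i) ->
  kunz_set f = kunz_set g.
Proof.
by move=> fg; apply/seteqP; split => s /=; rewrite /kunz_set /= fg ?ltn_pmod.
Qed.

Lemma kunz_set_inj f g : kunz_set f = kunz_set g ->
  forall i, (i < m)%N -> f i = g i.
Proof.
move=> fg i im; have H x : (f i <= x)%N = (g i <= x)%N.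
  by apply/idP/idP; rewrite -(kunz_setMD f x im) -(kunz_setMD g x im) fg.
by apply/eqP; rewrite eqn_leq -H leqnn H leqnn.
Qed.

Lemma kunz_set_m f : kunz f -> kunz_set f m.
Proof.
by move=> [f0 _]; rewrite -[m]addn0 -[X in (X + _)%N]mul1n kunz_setMD// f0.
Qed.

Lemma kunz_set_semigroup f : kunz f -> numerical_semigroup (kunz_set f).
Proof.
move=> [f0 fadd]; split.
- by rewrite /kunz_set /= mod0n div0n f0.
- move=> a b; rewrite /kunz_set /= => fa fb.
  rewrite -modnDm divnD//.
  apply: leq_trans (fadd _ _ (ltn_pmod a m_gt0) (ltn_pmod b m_gt0)) _.
  by rewrite leq_add2r leq_add.
- pose M := (\sum_(i < m) f i)%N.
  apply: (@sub_finite_set _ _ `I_(M * m)%N); last exact: finite_II.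
  move=> s /=; rewrite /kunz_set /= => /negP; rewrite -ltnNge => sf.
  rewrite -ltn_divLR//; apply: (leq_trans sf).
  by rewrite /M (bigD1 (Ordinal (ltn_pmod s m_gt0)))//= leq_addr.
Qed.

Lemma finite_set_nat_ub (A : set nat) : finite_set A ->
  exists N, forall a, A a -> (a <= N)%N.
Proof.
move=> fA; exists (\sum_(a <- fset_set A) a)%N => a Aa.
by rewrite (big_fsetD1 a)/= ?leq_addr// in_fset_set// inE.
Qed.

(** Finiteness of the complement puts an element of [S] in each class, and adding [m] stays in [S];
    so [S] is determined by the least quotient in each class. *)
Lemma semigroup_kunz S : numerical_semigroup S -> S m ->
  exists2 f, kunz f & S = kunz_set f.
Proof.
move=> [S0 Sadd Sfin] Sm.
have Sx i x y : S (x * m + i)%N -> (x <= y)%N -> S (y * m + i)%N.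
  move=> Si /subnK <-; elim: (y - x)%N => // z IH.
  by rewrite addSn mulSn -addnA; apply: Sadd.
have /choice[f fP] i : exists x, forall y, S (y * m + i)%N <-> (x <= y)%N.
  have ex : exists x, `[< S (x * m + i)%N >].
    have [N NP] := finite_set_nat_ub Sfin.
    exists N.+1; apply/asboolP; apply: contrapT => /NP; apply/negP.
    by rewrite -ltnNge ltn_addr// (leq_trans _ (leq_pmulr _ m_gt0)).
  case: (ex_minnP ex) => x /asboolP Six xmin; exists x => y; split.
    by move=> Siy; apply: xmin; apply/asboolP.
  exact: Sx.
have SE : S = kunz_set f.
  apply/seteqP; split => s; rewrite /kunz_set /=.
    by rewrite [X in S X](divn_eq s m) => /fP.
  by move=> /fP; rewrite -divn_eq.
exists f => //; split.
  by apply/eqP; rewrite -leqn0; apply/fP.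
move=> i j im jm; apply/fP.
have Si : S (f i * m + i)%N by apply/fP.
have Sj : S (f j * m + j)%N by apply/fP.
have := Sadd _ _ Si Sj; suff -> : (f i * m + i + (f j * m + j) =
  (f i + f j + (m <= i + j)) * m + (i + j) %% m)%N by [].
rewrite addnACA -mulnDl [in LHS](divn_eq (i + j) m) addnA -mulnDl.
by rewrite divnD// (divn_small im) (divn_small jm) (modn_small im) (modn_small jm).
Qed.

(** The gaps in class [i] are the numbers [x * m + i] with [x < f i]. *)
Lemma genus_kunz_set f : genus (kunz_set f) = (\sum_(i < m) f i)%N.
Proof.
pose T := {i : 'I_m & 'I_(f i)}.
pose phi (t : T) : nat := (tagged t * m + tag t)%N.
have phi_inj : injective phi.
  move=> [i x] [j y]; rewrite /phi /= => E.
  have ij : i = j.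
    apply: val_inj => /=; have := congr1 (modn^~ m) E.
    by rewrite !modnMDl !modn_small.
  subst j; congr existT; apply: val_inj => /=.
  by move/addIn: E => /eqP; rewrite eqn_pmul2r// => /eqP.
rewrite /genus (_ : ~` _ = phi @` [set t | t \in [set: T]%SET]).
  rewrite card_fset_set_finset// cardsT card_tagged sumnE big_map big_enum /=.
  by apply: eq_bigr => i _; rewrite card_ord.
apply/seteqP; split => s /=.
  rewrite /kunz_set /= => /negP; rewrite -ltnNge => sf.
  exists (Tagged (fun i : 'I_m => 'I_(f i))
    (Ordinal (sf : (s %/ m < f (Ordinal (ltn_pmod s m_gt0)))%N))).
    by rewrite inE.
  by rewrite [RHS](divn_eq s m).
move=> [[i x] _ <-]; rewrite /phi /= kunz_setMD//.
by apply/negP; rewrite -ltnNge.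
Qed.

(** The residue [i] itself lies in the set exactly when [f i = 0]. *)
Lemma kunz_set_multiplicity f : kunz f ->
  has_multiplicity (kunz_set f) m <->
  forall i, (0 < i < m)%N -> (0 < f i)%N.
Proof.
move=> kf; split=> [[_ _ fm] i /andP[i0 im]|fpos].
  rewrite lt0n; apply/negP => /eqP fi0.
  suff /fm : kunz_set f i by move=> /(_ i0); rewrite leqNgt im.
  by rewrite /kunz_set /= modn_small// fi0.
split => //; first exact: kunz_set_m.
move=> s fs s0; rewrite leqNgt; apply/negP => sm.
by move: fs; rewrite /kunz_set /= modn_small// divn_small// leqNgt fpos ?s0.
Qed.

End Kunz.

(** * The two cones *)

Section Coordinates.
Context {R : realType} {n : nat}.
Implicit Type x y : 'rV[R]_n.

Lemma coord1S x (j : 'I_n) : coord1 x j.+1 = x 0 j.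
Proof. by rewrite /coord1 (big_pred1 j)// => i; rewrite eqSS. Qed.

Lemma coord1_0 x : coord1 x 0 = 0.
Proof. by rewrite /coord1 big_pred0. Qed.

Lemma coord1_row (f : nat -> R) a : (0 < a <= n)%N ->
  coord1 (\row_(j < n) f j.+1) a = f a.
Proof. by case: a => // a an; rewrite (coord1S _ (Ordinal an)) mxE. Qed.

Lemma coord1_inj x y : (forall a, (0 < a <= n)%N -> coord1 x a = coord1 y a) ->
  x = y.
Proof.
by move=> xy; apply/rowP => j; rewrite -!coord1S xy//= ltn_ord.
Qed.

Lemma coord1_int x a : x \is a mxOver Num.int -> coord1 x a \is a Num.int.
Proof. by move=> /mxOverP xi; rewrite rpred_sum. Qed.

(** This column is zero for [a = 0], so the functionals below treat sums congruent to 0 like the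
    others. *)
Definition coord1_col (a : nat) : 'cV[R]_n := \col_j (j.+1 == a)%:R.

Lemma pair_coord1 x a : (x *m coord1_col a) 0 0 = coord1 x a.
Proof.
rewrite mxE /coord1 [RHS]big_mkcond; apply: eq_bigr => j _; rewrite mxE.
by case: eqP => _; rewrite ?mulr1 ?mulr0.
Qed.

End Coordinates.

(** * Semigroups of multiplicity [m] and the group cone *)

Section GroupCone.
Context {R : realType} {n : nat}.
Notation m := n.+2.
Implicit Type x : 'rV[R]_n.+1.

Definition kunz_index : finType := ('I_n.+1 * option 'I_n.+1)%type.

Definition kunz_functional (i : kunz_index) : 'cV[R]_n.+1 :=
  match i with
  | (a, None) => coord1_col a.+1
  | (a, Some b) => coord1_col a.+1 + coord1_col b.+1
                   - coord1_col ((a.+1 + b.+1) %% m)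
  end.

(** Multiplicity [m] forces Kunz coordinates to be at least 1, and subadditivity holds only up to
    the carry. *)
Definition kunz_shift (i : kunz_index) : R :=
  match i with
  | (a, None) => 1
  | (a, Some b) => - (m <= a.+1 + b.+1)%N%:R
  end.

Definition sum_col : 'cV[R]_n.+1 := const_mx 1.

Lemma pair_sum_col x : (x *m sum_col) 0 0 = \sum_(j < n.+1) x 0 j.
Proof. by rewrite mxE; apply: eq_bigr => j _; rewrite mxE mulr1. Qed.

(* [s] tells the shifted inequalities satisfied by Kunz coordinates from the
   homogeneous ones of the cone. *)
Lemma kunz_functionalP x (s : bool) :
  (forall i, (if s then kunz_shift i else 0) <= (x *m kunz_functional i) 0 0) <->
  (forall a, (0 < a < m)%N -> s%:R <= coord1 x a) /\
  (forall a b, (0 < a < m)%N -> (0 < b < m)%N ->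
    coord1 x ((a + b) %% m) <= coord1 x a + coord1 x b + (s && (m <= a + b)%N)%:R).
Proof.
split=> [H|[H1 H2] [a [b|]]].
- split=> [[//|a] an|[//|a] [//|b] an bn].
    by have := H (Ordinal (an : (a < n.+1)%N), None); rewrite /= pair_coord1; case: s {H}.
  have := H (Ordinal (an : (a < n.+1)%N), Some (Ordinal (bn : (b < n.+1)%N))).
  by rewrite /= !(pairDr, pairNr) !pair_coord1; case: s {H}; rewrite /= ?addr0; lra.
- have := H2 a.+1 b.+1 (ltn_ord a) (ltn_ord b).
  by rewrite /= !(pairDr, pairNr) !pair_coord1; case: s {H1 H2}; rewrite /= ?addr0; lra.
- by have := H1 a.+1 (ltn_ord a); rewrite /= pair_coord1; case: s {H1 H2}.
Qed.

Lemma bounded_of_sum x s : (forall a, (0 < a < m)%N -> 0 <= coord1 x a) ->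
  (x *m sum_col) 0 0 = s -> forall j, `|x 0 j| <= s.
Proof.
move=> x0 <- j; have x0' i : 0 <= x 0 i.
  by rewrite -coord1S; apply: x0; exact: ltn_ord i.
by rewrite ger0_norm// pair_sum_col (bigD1 j)//= lerDl sumr_ge0.
Qed.

Lemma sum_coord1 x : \sum_(1 <= a < m) coord1 x a = (x *m sum_col) 0 0.
Proof.
rewrite pair_sum_col big_add1 /= big_mkord.
by apply: eq_bigr => j _; rewrite coord1S.
Qed.

Lemma group_cone_ge0 x : group_cone R m x -> (x *m sum_col) 0 0 = 1 ->
  forall a, (0 < a < m)%N -> 0 <= coord1 x a.
Proof.
move=> xC x1; apply: subadditive_ge0 => // a am aa.
(* It remains to treat [2 a = m]. If [a = 1], then [m = 2] and the normalization gives [x_1 = 1].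
   Otherwise the inequalities for [a + 1] and for [a + (a + 1) = m + 1] add up to [0 <= 2 x_a]. *)
have [a1|a1] := eqVneq a 1%N.
  rewrite -sum_coord1 -aa a1 big_nat1 in x1.
  by rewrite a1 x1 ler01.
have e1 : ((a + 1) %% m = a.+1)%N by rewrite modn_small ?addn1//; lia.
have e2 : ((a + a.+1) %% m = 1)%N by rewrite addnS aa -addn1 modnDl modn_small.
have am1 : (0 < a.+1 < m)%N by lia.
have := xC a 1%N am isT; have := xC a a.+1 am am1.
by rewrite e1 e2 => /(_ isT) h2 /(_ isT) h1; lra.
Qed.

Lemma group_cone_slice :
  group_cone R m `&` [set x : 'rV[R]_n.+1 | \sum_(1 <= i < m) coord1 x i = 1] =
  slice sum_col kunz_functional.
Proof.
apply/seteqP; split => x /=; rewrite sum_coord1.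
  move=> [xC x1]; split => //; apply/(kunz_functionalP x false).
  have x0 := group_cone_ge0 xC x1; split => // a b am bm; rewrite addr0.
  have [ab|ab] := eqVneq ((a + b) %% m)%N 0%N; last exact: xC.
  by rewrite ab coord1_0 addr_ge0 ?x0.
move=> [x1 /(kunz_functionalP x false)[x0 xC]]; split => // a b am bm _.
by rewrite -[leRHS]addr0 xC.
Qed.

Let f x (a : nat) : nat := Num.truncn (coord1 x a).

(** The coordinate sum is the genus, the lower bound 1 is the multiplicity condition, and shifted
    subadditivity is closure under addition. *)
Lemma semigroup_lattice_points g : semigroup_count m g =
  #|` fset_set (lattice_points sum_col kunz_functional kunz_shift g)|%fset.
Proof.
set X := lattice_points _ _ _ _.
have fE x a : X x -> (a < m)%N -> (f x a)%:R = coord1 x a.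
  move=> [xi _ /(kunz_functionalP x true)[x0 _]] am; apply: truncnK.
  case: a am => [|a] am; first by rewrite coord1_0.
  by rewrite natrEint coord1_int//= (le_trans _ (x0 a.+1 am)).
have kf x : X x -> kunz m (f x).
  move=> Xx; have [_ _ /(kunz_functionalP x true)[_ xadd]] := Xx; split.
    by rewrite /f coord1_0 truncn0.
  case=> [|a] b am bm.
    by rewrite add0n modn_small// -addnA addnCA leq_addr.
  case: b bm => [|b] bm; first by rewrite addn0 modn_small// -addnA leq_addr.
  rewrite -(ler_nat R) !natrD !fE//; last by rewrite ltn_mod.
  exact: xadd.
rewrite -(@card_fset_set_image _ _ (fun x => kunz_set m (f x))); last first.
  move=> x y /set_mem Xx /set_mem Xy E; apply: coord1_inj => a /andP[a0 an].
  by rewrite -!fE// (kunz_set_inj _ E).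
congr (#|` fset_set _|%fset); apply/seteqP; split => S /=.
  move=> [SS Sm Sg]; have [_ Sm' _] := Sm.
  have [F kF SF] := semigroup_kunz (ltn0Sn _) SS Sm'.
  pose x : 'rV[R]_n.+1 := \row_(j < n.+1) (F j.+1)%:R.
  have xE a : (a < m)%N -> coord1 x a = (F a)%:R.
    case: a => [|a] am; first by rewrite coord1_0 (proj1 kF).
    exact: (coord1_row (fun a => (F a)%:R)).
  have Fpos : forall a, (0 < a < m)%N -> (0 < F a)%N.
    by apply/kunz_set_multiplicity; rewrite -?SF.
  exists x; last first.
    by rewrite SF; apply: eq_kunz_set => // a am; rewrite /f xE// natrK.
  split.
  - by apply/mxOverP => i j; rewrite mxE natr_int.
  - rewrite -sum_coord1 -Sg SF genus_kunz_set// big_ord_recl (proj1 kF) add0n.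
    rewrite big_add1 /= big_mkord natr_sum; apply: eq_bigr => j _.
    by rewrite xE//= ltnS.
  - apply/(kunz_functionalP x true); split => [a am|a b am bm].
      by rewrite xE ?ler1n ?Fpos//; case/andP: am.
    have [_ am'] := andP am; have [_ bm'] := andP bm.
    by rewrite !xE ?ltn_mod// -!natrD ler_nat; apply: (proj2 kF).
move=> [x Xx <-]; have kx := kf _ Xx.
have [_ xg /(kunz_functionalP x true)[x1 _]] := Xx.
split; first exact: kunz_set_semigroup.
  apply/kunz_set_multiplicity => // a /[dup] am /andP[_ am'].
  by rewrite -(ltr0n R) fE// (lt_le_trans _ (x1 _ am)).
apply/eqP; rewrite -(eqr_nat R) genus_kunz_set// natr_sum big_ord_recl.
rewrite fE// coord1_0 add0r -xg -sum_coord1 big_add1 /= big_mkord.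
by apply/eqP; apply: eq_bigr => j _; rewrite fE//= ltnS.
Qed.

Lemma group_cone_volume (p : nat -> R) (gamma : R) (G : nat) :
  quasipolynomial n gamma p ->
  (forall g, (G <= g)%N -> (semigroup_count m g)%:R = p g) ->
  relative_volume (group_cone R m `&`
    [set x : 'rV[R]_n.+1 | \sum_(1 <= i < m) coord1 x i = 1]) = gamma%:E.
Proof.
move=> qp pG; rewrite group_cone_slice.
(* The offset [G] keeps every dilation factor in the range where [p] is the count. *)
pose k q := (q + G).+1.
have kq q : (q < k q)%N by rewrite ltnS leq_addr.
(* Equal positive coordinates satisfy all the inequalities strictly. *)
pose c : 'rV[R]_n.+1 := const_mx n.+1%:R^-1.
have n0 : 0 < n.+1%:R^-1 :> R by rewrite invr_gt0.
have cE a : (0 < a < m)%N -> coord1 c a = n.+1%:R^-1.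
  by case: a => // a am; rewrite (coord1S _ (Ordinal (am : (a < n.+1)%N))) mxE.
apply: (@relative_volume_slice _ _ _ _ ord0 _ c _ _ _ _ kunz_shift k).
- by move=> j; rewrite mxE.
- by rewrite mxE.
- rewrite pair_sum_col; under eq_bigr do rewrite mxE.
  by rewrite sumr_const card_ord -[LHS]mulr_natr mulVf.
- case=> a [b|] /=; rewrite ?(pairDr, pairNr) !pair_coord1.
    rewrite (cE a.+1 (ltn_ord a)) (cE b.+1 (ltn_ord b)).
    have [->|ab] := posnP ((a.+1 + b.+1) %% m); last first.
      by rewrite cE ?ab ?ltn_mod// addrK.
    by rewrite coord1_0 subr0 addr_gt0.
  by rewrite (cE a.+1 (ltn_ord a)).
- move=> x [x1 /(kunz_functionalP x false)[x0 _]]; exact: bounded_of_sum.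
- by move=> q; exact: leq_ltn_trans (kq q).
- exact: inv_nat_cvg0.
- move=> q x [_ xk /(kunz_functionalP x true)[x1 _]]; apply: bounded_of_sum => //.
  by move=> a /x1; apply: le_trans.
- have kG q : (G <= k q)%N by rewrite /k; lia.
  under eq_fun do rewrite -semigroup_lattice_points pG//.
  exact: quasipolynomial_cvg.
Qed.

End GroupCone.

(** * Oversemigroups and the oversemigroup cone *)

Section OversemigroupCone.
Context {R : realType} {n : nat}.
Notation m := n.+2.
Implicit Type y : 'rV[R]_n.+2.

Definition over_index : finType := ('I_m + 'I_n.+1 * 'I_n.+1)%type.

(** For indices with sum [m] the second branch is [coord1_col 0 + coord1_col m], that is
    [coord1_col m], which covers the last clause of the cone. *)
Definition over_functional (i : over_index) : 'cV[R]_n.+2 :=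
  match i with
  | inl a => coord1_col a.+1
  | inr (a, b) =>
      (if (a.+1 + b.+1 < m)%N then coord1_col (a.+1 + b.+1)
       else coord1_col (a.+1 + b.+1 - m) + coord1_col m)
      - coord1_col a.+1 - coord1_col b.+1
  end.

Let target y (s : nat) : R :=
  if (s < m)%N then coord1 y s else coord1 y (s - m) + coord1 y m.

Lemma over_functionalP y :
  (forall i, 0 <= (y *m over_functional i) 0 0) <->
  (forall a, (0 < a <= m)%N -> 0 <= coord1 y a) /\
  (forall a b, (0 < a < m)%N -> (0 < b < m)%N ->
    coord1 y a + coord1 y b <= target y (a + b)).
Proof.
have E (a b : 'I_n.+1) : (y *m over_functional (inr (a, b))) 0 0 =
    target y (a.+1 + b.+1) - coord1 y a.+1 - coord1 y b.+1.
  rewrite /= /target; case: ifP => _;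
    by rewrite !(pairDr, pairNr) !pair_coord1.
split=> [H|[H1 H2] [a|[a b]]].
- split=> [[//|a] am|[//|a] [//|b] am bm].
    by have := H (inl (Ordinal (am : (a < m)%N))); rewrite /= pair_coord1.
  have := H (inr (Ordinal (am : (a < n.+1)%N), Ordinal (bm : (b < n.+1)%N))).
  by rewrite E /=; lra.
- by rewrite /= pair_coord1; apply: H1; exact: ltn_ord a.
- by rewrite E; have := H2 a.+1 b.+1 (ltn_ord a) (ltn_ord b); lra.
Qed.

Lemma oversemigroup_cone_slice :
  oversemigroup_cone R m `&` [set y : 'rV[R]_n.+2 | coord1 y m = 1] =
  slice (coord1_col m) over_functional.
Proof.
apply/seteqP; split => y /=.
  move=> [[y0 ylt ygt yeq] y1]; split; first by rewrite pair_coord1.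
  apply/over_functionalP; split => //.
  have sym a b : (0 < a)%N -> (a <= b)%N -> (b < m)%N ->
      coord1 y a + coord1 y b <= target y (a + b).
    move=> a0 ab bm; rewrite /target; case: ltngtP => abm.
    - exact: ylt.
    - exact: ygt.
    - by rewrite abm subnn coord1_0 add0r; exact: yeq.
  move=> a b /andP[a0 am] /andP[b0 bm].
  have [ab|/ltnW ab] := leqP a b; first exact: sym.
  by rewrite addrC addnC; exact: sym.
move=> [y1 /over_functionalP[y0 yadd]]; rewrite pair_coord1 in y1.
split => //; split => // i j i1 ij jm.
- by move=> ijm; have := yadd i j; rewrite /target ijm; apply; lia.
- move=> ijm; have := yadd i j; rewrite /target.
  have -> : (i + j < m)%N = false by lia.
  by apply; lia.
- move=> ijm; have := yadd i j; rewrite /target ijm ltnn subnn coord1_0 add0r.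
  by apply; lia.
Qed.

(** The coordinates [y_j] and [y_(m - j)] are nonnegative with sum at most [y_m]. *)
Lemma over_functional_bounded y s : (y *m coord1_col m) 0 0 = s ->
  (forall i, 0 <= (y *m over_functional i) 0 0) -> forall j, `|y 0 j| <= s.
Proof.
rewrite pair_coord1 => <- /over_functionalP[y0 yadd] j.
rewrite -coord1S ger0_norm; last by apply: y0; exact: ltn_ord j.
have [->//|jm] := eqVneq (j.+1) m.
have jm' : (j.+1 < m)%N by rewrite ltn_neqAle jm ltn_ord.
have := yadd j.+1 (m - j.+1)%N; rewrite /target subnKC ?(ltnW jm')//.
rewrite ltnn subnn coord1_0 add0r => h.
have : coord1 y j.+1 + coord1 y (m - j.+1) <= coord1 y m by apply: h; lia.
have : 0 <= coord1 y (m - j.+1) by apply: y0; lia.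
lra.
Qed.

(** The defect [b y_m - m y_b] is subadditive modulo [m], hence nonnegative by [subadditive_ge0]. *)
Lemma over_functional_le y q : (y *m coord1_col m) 0 0 = (m * q).+1%:R ->
  (forall i, 0 <= (y *m over_functional i) 0 0) ->
  forall a, (0 < a < m)%N -> m%:R * coord1 y a <= a%:R * (m * q).+1%:R.
Proof.
rewrite pair_coord1 => <- /over_functionalP[_ yadd] a am.
rewrite -subr_ge0; move: a am.
pose w b : R := b%:R * coord1 y m - m%:R * coord1 y b.
have m0 : 0 <= m%:R :> R by [].
apply: (@subadditive_ge0 R m w).
  move=> a b am bm; have [abm|abm|->] := ltngtP (a + b)%N m; last by rewrite modnn.
    move=> _; rewrite modn_small//.
    have := ler_wpM2l m0 (yadd _ _ am bm); rewrite /target abm /w natrD.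
    move: (m%:R : R) => M; lra.
  have abE : (a + b = (a + b - m) + m)%N by lia.
  move=> _; rewrite abE modnDr modn_small; last by lia.
  have := ler_wpM2l m0 (yadd _ _ am bm); rewrite /target.
  have -> : (a + b < m)%N = false by lia.
  have : (a%:R + b%:R : R) = (a + b - m)%:R + m%:R by rewrite -!natrD -abE.
  rewrite /w; move: (m%:R : R) ((a + b - m)%:R : R) => M s sE h.
  rewrite -subr_ge0.
  have -> : a%:R * coord1 y m - M * coord1 y a + (b%:R * coord1 y m - M * coord1 y b) -
     (s * coord1 y m - M * coord1 y (a + b - m)) =
     (a%:R + b%:R) * coord1 y m - s * coord1 y m - M * (coord1 y a + coord1 y b)
      + M * coord1 y (a + b - m) by ring.
  by rewrite sE; lra.
move=> a am aa; have := ler_wpM2l m0 (yadd _ _ am am); rewrite /target aa ltnn.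
rewrite subnn coord1_0 add0r /w.
have : (m%:R : R) = a%:R + a%:R by rewrite -natrD aa.
move: (m%:R : R) => M ->; lra.
Qed.

(** For the generator [m q + 1], the least element of class [i] is
    [i (m q + 1) - m y_i = m (i q - y_i) + i], so its Kunz coordinate is [i q - y_i]. *)
Let f (q : nat) y (a : nat) : nat := Num.truncn (a%:R * q%:R - coord1 y a).

Lemma oversemigroup_lattice_points q : oversemigroup_count m (m * q).+1 =
  #|` fset_set (lattice_points (coord1_col m) over_functional (fun=> 0 : R)
        (m * q).+1)|%fset.
Proof.
set X := lattice_points _ _ _ _.
have fE y a : X y -> (a < m)%N -> (f q y a)%:R = a%:R * q%:R - coord1 y a.
  move=> [yi ym yL] am; apply: truncnK.
  have zi : a%:R * q%:R - coord1 y a \is a Num.int.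
    by rewrite rpredB ?rpredM ?natr_int ?coord1_int.
  rewrite natrEint zi /=.
  case: a am zi => [|a] am zi; first by rewrite coord1_0 mul0r subr0.
  have := over_functional_le ym yL (am : 0 < a.+1 < m)%N.
  rewrite -[(m * q).+1%:R]natr1 natrM mulrDr mulr1 mulrCA => h.
  (* The bound on [m y_a] gives [m (a q - y_a) >= - a > - m]; an integer greater than -1 is
     nonnegative. *)
  have : -1 < a.+1%:R * q%:R - coord1 y a.+1.
    have m0 : 0 < m%:R :> R by [].
    have am' : a.+1%:R < m%:R :> R by rewrite ltr_nat.
    rewrite -(ltr_pM2l m0); move: h am'; move: (m%:R : R) => M; lra.
  case/intrP: zi => z ->.
  rewrite -[-1]/((-1)%:~R) ltr_int ler0z; lia.
have kf y : X y -> kunz m (f q y).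
  move=> Xy; have [_ ym /over_functionalP[_ yadd]] := Xy.
  rewrite pair_coord1 in ym; split.
    by rewrite /f coord1_0 mul0r subr0 truncn0.
  case=> [|a] b am bm.
    by rewrite add0n modn_small// -addnA addnCA leq_addr.
  case: b bm => [|b] bm; first by rewrite addn0 modn_small// -addnA leq_addr.
  rewrite -(ler_nat R) !natrD !fE//; last by rewrite ltn_mod.
  have := yadd a.+1 b.+1 am bm; rewrite /target.
  case: ltnP => abm; first by rewrite modn_small// natrD /=; lra.
  have abE : (a.+1 + b.+1 = (a.+1 + b.+1 - m) + m)%N by lia.
  rewrite ym.
  have -> : ((a.+1 + b.+1) %% m = a.+1 + b.+1 - m)%N.
    by rewrite [in LHS]abE modnDr modn_small//; lia.
  have : (a.+1%:R + b.+1%:R : R) = (a.+1 + b.+1 - m)%:R + m%:R.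
    by rewrite -!natrD -abE.
  rewrite -[(m * q).+1%:R]natr1 natrM /=.
  move: (m%:R : R) ((a.+1 + b.+1 - m)%:R : R) => M s sE h.
  have : (a.+1%:R + b.+1%:R) * q%:R = (s + M) * q%:R by rewrite sE.
  lra.
rewrite -(@card_fset_set_image _ _ (fun y => kunz_set m (f q y))); last first.
  move=> x y /set_mem Xx /set_mem Xy E; apply: coord1_inj => a /andP[a0].
  rewrite leq_eqVlt => /orP[/eqP ->|am].
    have [_ xm _] := Xx; have [_ ym _] := Xy.
    by rewrite pair_coord1 in xm; rewrite pair_coord1 in ym; rewrite xm ym.
  have := fE _ _ Xx am; rewrite (kunz_set_inj _ E)// fE// => /addrI/oppr_inj.
  by [].
have qE : (m * q).+1 = (q * m + 1)%N by rewrite addn1 mulnC.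
congr (#|` fset_set _|%fset); apply/seteqP; split => S /=.
  move=> [SS Sm Sq]; have [F kF SF] := semigroup_kunz (ltn0Sn _) SS Sm.
  have F1 : (F 1 <= q)%N by move: Sq; rewrite SF qE kunz_setMD.
  (* [F 1 <= q] says that [m q + 1] lies in [S]. Adding class 1 repeatedly causes no carry below
     [m], which yields [0 <= y_a]. *)
  have Fle a : (a < m)%N -> (F a <= a * q)%N.
    elim: a => [|a IH] am; first by rewrite (proj1 kF).
    have := (proj2 kF) a 1%N (ltnW am) isT.
    rewrite addn1 modn_small// [(m <= _)%N]leqNgt am /= addn0.
    move=> /leq_trans; apply.
    by rewrite mulSn addnC leq_add// IH// ltnW.
  pose Y a : R := if (a < m)%N then a%:R * q%:R - (F a)%:R else (m * q).+1%:R.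
  pose y : 'rV[R]_n.+2 := \row_(j < m) Y j.+1.
  have yE a : (a < m)%N -> coord1 y a = a%:R * q%:R - (F a)%:R.
    case: a => [|a] am; first by rewrite coord1_0 (proj1 kF) mul0r subr0.
    by rewrite /y coord1_row ?(ltnW am)// /Y am.
  have ym : coord1 y m = (m * q).+1%:R.
    by rewrite /y (coord1_row Y) ?leqnn// /Y ltnn.
  exists y; last first.
    rewrite SF; apply: eq_kunz_set => // a am; rewrite /f yE//.
    by rewrite opprB addrCA subrr addr0 natrK.
  split.
  - apply/mxOverP => i j; rewrite mxE /Y; case: ifP => _; last exact: natr_int.
    by rewrite rpredB ?rpredM ?natr_int.
  - by rewrite pair_coord1.
  - apply/over_functionalP; split => [a /andP[a0]|a b /andP[a0 am] /andP[b0 bm]].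
      rewrite leq_eqVlt => /orP[/eqP ->|am]; first by rewrite ym.
      by rewrite yE// subr_ge0 -natrM ler_nat Fle.
    have := (proj2 kF) a b am bm; rewrite -(ler_nat R) !natrD (yE a)// (yE b)//.
    rewrite /target; case: (ltnP (a + b)%N m) => abm.
      by rewrite modn_small// yE// natrD /=; lra.
    have abE : (a + b = (a + b - m) + m)%N by lia.
    have -> : ((a + b) %% m = a + b - m)%N.
      by rewrite [in LHS]abE modnDr modn_small//; lia.
    rewrite ym yE; last by lia.
    have : (a%:R + b%:R : R) = (a + b - m)%:R + m%:R by rewrite -!natrD -abE.
    rewrite -[(m * q).+1%:R]natr1 natrM /=.
    move: (m%:R : R) ((a + b - m)%:R : R) => M s sE h.
    have : (a%:R + b%:R) * q%:R = (s + M) * q%:R by rewrite sE.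
    lra.
move=> [y Xy <-]; have ky := kf _ Xy.
split; [exact: kunz_set_semigroup|exact: kunz_set_m|].
rewrite qE kunz_setMD// -(ler_nat R) fE// mul1r gerBl.
by have [_ _ /over_functionalP[y0 _]] := Xy; exact: y0.
Qed.

Lemma oversemigroup_cone_volume (H : nat -> R) (lambda : R) :
  quasipolynomial n.+1 lambda H ->
  (forall q, (0 < q)%N -> coprime m q -> H q = (oversemigroup_count m q)%:R) ->
  relative_volume (oversemigroup_cone R m `&`
    [set y : 'rV[R]_n.+2 | coord1 y m = 1]) = lambda%:E.
Proof.
move=> qp HE; rewrite oversemigroup_cone_slice.
pose k q := (m * q).+1.
have kq q : (q < k q)%N by rewrite ltnS leq_pmull.
(* With [y_a = a / m] the inequalities between sums would be equalities. Subtracting [1 / (2 m)] for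
   [a < m] makes them strict, since the left-hand side loses this amount twice and the right-hand
   side at most once. *)
pose Y a : R := if (a < m)%N then (a%:R - 2^-1) / m%:R else 1.
pose c : 'rV[R]_n.+2 := \row_(j < m) Y j.+1.
have m0 : 0 < m%:R :> R by [].
have cm : coord1 c m = 1 by rewrite /c (coord1_row Y) ?leqnn// /Y ltnn.
have cE a : (0 < a < m)%N -> coord1 c a = (a%:R - 2^-1) / m%:R.
  by move=> /andP[a0 am]; rewrite /c coord1_row ?a0 ?(ltnW am)// /Y am.
apply: (@relative_volume_slice _ _ _ _ ord_max _ c _ _ _ _ (fun=> 0) k).
- by move=> j; rewrite mxE natr_int.
- by rewrite mxE eqxx.
- by rewrite pair_coord1.
- case=> [a|[a b]] /=.
    rewrite pair_coord1; have [->|am] := eqVneq a.+1 m; first by rewrite cm.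
    rewrite cE; last by rewrite /= ltn_neqAle am ltn_ord.
    by rewrite divr_gt0// -natr1; have : 0 <= a%:R :> R by []; lra.
  rewrite !(pairDr, pairNr) !pair_coord1 (cE a.+1 (ltn_ord a)) (cE b.+1 (ltn_ord b)).
  rewrite -addrA -opprD -mulrDl subr_gt0.
  case: ltngtP => abm; rewrite ?(pairDr, pair_coord1) ?cm.
  + rewrite cE; last by rewrite abm.
    by rewrite ltr_pM2r ?invr_gt0// natrD; lra.
  + rewrite cE; last by move: (ltn_ord a) (ltn_ord b); lia.
    rewrite ltr_pdivrMr// mulrDl mul1r divfK ?gt_eqF//.
    by rewrite natrB ?(ltnW abm)// natrD; lra.
  + rewrite abm subnn coord1_0 add0r ltr_pdivrMr// mul1r -abm natrD; lra.
- move=> y [y1 yL]; exact: over_functional_bounded.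
- by [].
- exact: inv_nat_cvg0.
- move=> q y [_ yk yL]; exact: over_functional_bounded.
- have Hk q : (oversemigroup_count m (k q))%:R = H (k q).
    rewrite HE// /coprime (_ : k q = (q * m + 1)%N); last first.
      by rewrite /k addn1 mulnC.
    by rewrite gcdnMDl gcdn1.
  under eq_fun do rewrite -oversemigroup_lattice_points Hk.
  exact: quasipolynomial_cvg.
Qed.

End OversemigroupCone.

Theorem theorem6p1 (R : realType) (m : nat) (hm : (2 <= m)%N) :
  (forall (p : nat -> R) (gamma : R),
     quasipolynomial (m - 2) gamma p ->
     (exists G : nat, forall g : nat, (G <= g)%N ->
        (semigroup_count m g)%:R = p g) ->
     gamma%:E = relative_volume
       (group_cone R m `&`
        [set x : 'rV[R]_m.-1 | \sum_(1 <= i < m) coord1 x i = 1]))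
  /\
  (forall (H : nat -> R) (lambda : R),
     quasipolynomial (m - 1) lambda H ->
     (forall q : nat, (0 < q)%N -> coprime m q ->
        H q = (oversemigroup_count m q)%:R) ->
     lambda%:E = relative_volume
       (oversemigroup_cone R m `&`
        [set x : 'rV[R]_m | coord1 x m = 1])).
Proof.
case: m hm => [|[|n]]// _; rewrite subn2 subn1 /=; split.
  by move=> p gamma qp [G pG]; rewrite (group_cone_volume qp pG).
by move=> H lambda qH HE; rewrite (oversemigroup_cone_volume qH HE).
Qed.
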